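(* Consider the evolution equation $\dot x(t)=Ax(t)+g(x(t),d(t))$, where $A$ generates a $C_0$-semigroup $T(\cdot)$ on a Banach space $X$, $D$ is a nonempty subset of a normed linear space, and $g:X\times D\to X$ satisfies: (a) for every $C>0$ there is $L(C)>0$ such that $\|g(y,d)-g(x,d)\|_X\le L(C)\|y-x\|_X$ for all $x,y\in X$ with $\|x\|_X\le C$, $\|y\|_X\le C$ and all $d\in D$; (b) $g(x,\cdot)$ is continuous for every $x\in X$. Assume that the equation is robustly forward complete and that $0$ is an equilibrium. If there exists a non-coercive Lyapunov function for this equation, then it is uniformly globally asymptotically stable (UGAS) at $0$.
   Context: Notation: $\mathbb{R}_+=[0,\infty)$. $\mathcal{K}$ is the set of continuous strictly increasing $\gamma:\mathbb{R}_+\to\mathbb{R}_+$ with $\gamma(0)=0$; $\mathcal{K}_\infty$ is the set of unbounded $\gamma\in\mathcal{K}$; $\mathcal{L}$ is the set of continuous decreasing $\gamma:\mathbb{R}_+\to\mathbb{R}_+$ with $\lim_{t\to\infty}\gamma(t)=0$; $\mathcal{KL}$ is the set of $\beta:\mathbb{R}_+^2\to\mathbb{R}_+$ with $\beta(\cdot,t)\in\mathcal{K}$ for all $t\ge0$ and $\beta(r,\cdot)\in\mathcal{L}$ for all $r>0$. The disturbance set $\mathcal{D}$ is the set of globally bounded, piecewise continuous functions $d:\mathbb{R}_+\to D$. Solutions are mild solutions: $\phi(\cdot,x_0,d)=x(\cdot)$ is the continuous solution of $x(t)=T(t)x_0+\int_0^tT(t-s)g(x(s),d(s))\,ds$. Under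 (a), (b) the equation is well-posed and gives rise to a system $\Sigma=(X,\mathcal{D},\phi)$ as soon as it is forward complete (solutions exist on all of $\mathbb{R}_+$ for every $x_0\in X$, $d\in\mathcal{D}$). Robustly forward complete (RFC): solutions exist on $\mathbb{R}_+$ for all $x_0\in X$, $d\in\mathcal{D}$, and for all $C>0,\tau>0$, $\sup\{\|\phi(t,x,d)\|_X : \|x\|_X\le C,\ t\in[0,\tau],\ d\in\mathcal{D}\}<\infty$. Equilibrium: $\phi(t,0,d)=0$ for all $t\ge0$, $d\in\mathcal{D}$. Non-coercive Lyapunov function: a continuous $V:X\to\mathbb{R}_+$ with $V(0)=0$ for which there exist $\psi_2\in\mathcal{K}_\infty$ and $\alpha\in\mathcal{K}$ such that $0<V(x)\le\psi_2(\|x\|_X)$ for all $x\in X\setminus\{0\}$, and $\dot V_d(x):=\liminf_{t\to+0}\frac1t\big(V(\phi(t,x,d))-V(x)\big)\le-\alpha(\|x\|_X)$ for all $x\in X$, $d\in\mathcal{D}$. UGAS: there is $\beta\in\mathcal{KL}$ with $\|\phi(t,x,d)\|_X\le\beta(\|x\|_X,t)$ for all $x\in X$, $d\in\mathcal{D}$, $t\ge0$. *)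

(* Defs.v *)
From Stdlib Require Import Reals List.
From Coquelicot Require Import Coquelicot.
Open Scope R_scope.

(* Functions on [0, +oo) are represented by total functions on R whose values
   at negative arguments are never constrained. *)
Definition nonneg (t : R) : Prop := 0 <= t.

(** Comparison functions *)

Definition class_K (gamma : R -> R) : Prop :=
  continuous_on nonneg gamma /\
  (forall s t, 0 <= s -> s < t -> gamma s < gamma t) /\
  gamma 0 = 0.

Definition class_Kinf (gamma : R -> R) : Prop :=
  class_K gamma /\ (forall M, exists t, 0 <= t /\ M < gamma t).

Definition class_L (gamma : R -> R) : Prop :=
  continuous_on nonneg gamma /\
  (forall t, 0 <= t -> 0 <= gamma t) /\
  (forall s t, 0 <= s -> s <= t -> gamma t <= gamma s) /\
  is_lim gamma p_infty 0.

Definition class_KL (beta : R -> R -> R) : Prop :=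
  (forall t, 0 <= t -> class_K (fun r => beta r t)) /\
  (forall r, 0 < r -> class_L (fun t => beta r t)).

(** Disturbances *)

(* On each [0, tau]: finitely many discontinuities, all with one-sided limits.
   The value at a discontinuity is unrelated to these limits, which lie in the
   ambient space U. *)
Definition piecewise_continuous {U : UniformSpace} (d : R -> U) : Prop :=
  (forall tau, 0 < tau -> exists l : list R,
     forall t, 0 <= t <= tau -> ~ In t l ->
       filterlim d (within nonneg (locally t)) (locally (d t))) /\
  (forall t, 0 <= t -> exists u, filterlim d (at_right t) (locally u)) /\
  (forall t, 0 < t -> exists u, filterlim d (at_left t) (locally u)).

Definition disturbance {U : NormedModule R_AbsRing} (D : U -> Prop)
    (d : R -> U) : Prop :=
  (forall t, 0 <= t -> D (d t)) /\
  (exists M, forall t, 0 <= t -> norm (d t) <= M) /\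
  piecewise_continuous d.

(** Semigroups and mild solutions *)

(* [is_linear] includes boundedness of the operator. *)
Definition C0_semigroup {X : NormedModule R_AbsRing} (T : R -> X -> X) : Prop :=
  (forall t, 0 <= t -> is_linear (T t)) /\
  (forall x, T 0 x = x) /\
  (forall s t x, 0 <= s -> 0 <= t -> T (s + t) x = T s (T t x)) /\
  (forall x, filterlim (fun t => T t x) (at_right 0) (locally x)).

(* The unbounded operator A is given by its domain [domA] and by a total
   function that is only meaningful on [domA]. *)
Definition generates {X : NormedModule R_AbsRing} (domA : X -> Prop)
    (A : X -> X) (T : R -> X -> X) : Prop :=
  C0_semigroup T /\
  (forall x y, (domA x /\ A x = y) <->
     filterlim (fun t => scal (/ t) (minus (T t x) x)) (at_right 0) (locally y)).

Definition lipschitz_on_balls {X U : NormedModule R_AbsRing} (D : U -> Prop)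
    (g : X -> U -> X) : Prop :=
  forall C, 0 < C -> exists L, 0 < L /\
    forall x y d, norm x <= C -> norm y <= C -> D d ->
      norm (minus (g y d) (g x d)) <= L * norm (minus y x).

(* The integral is the Riemann integral of an X-valued function. *)
Definition mild_solution {X : CompleteNormedModule R_AbsRing}
    {U : NormedModule R_AbsRing} (T : R -> X -> X) (g : X -> U -> X)
    (x0 : X) (d : R -> U) (x : R -> X) : Prop :=
  continuous_on nonneg x /\
  (forall t, 0 <= t ->
     ex_RInt (fun s => T (t - s) (g (x s) (d s))) 0 t /\
     x t = plus (T t x0) (RInt (fun s => T (t - s) (g (x s) (d s))) 0 t)).

(* [phi t x d] is the state at time t; that such a phi exists is forward
   completeness of the equation. *)
Definition solution_map {X : CompleteNormedModule R_AbsRing}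
    {U : NormedModule R_AbsRing} (T : R -> X -> X) (g : X -> U -> X)
    (D : U -> Prop) (phi : R -> X -> (R -> U) -> X) : Prop :=
  forall x0 d, disturbance D d ->
    mild_solution T g x0 d (fun t => phi t x0 d).

(** Stability notions *)

Definition robustly_forward_complete {X : CompleteNormedModule R_AbsRing}
    {U : NormedModule R_AbsRing} (T : R -> X -> X) (g : X -> U -> X)
    (D : U -> Prop) (phi : R -> X -> (R -> U) -> X) : Prop :=
  solution_map T g D phi /\
  (forall C tau, 0 < C -> 0 < tau -> exists K,
     forall x t d, norm x <= C -> 0 <= t <= tau -> disturbance D d ->
       norm (phi t x d) <= K).

Definition equilibrium_at_0 {X U : NormedModule R_AbsRing} (D : U -> Prop)
    (phi : R -> X -> (R -> U) -> X) : Prop :=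
  forall t d, 0 <= t -> disturbance D d -> phi t zero d = zero.

(* Lower limit as t -> 0+, with values in the extended reals:
   sup over delta > 0 of inf { q t | 0 < t < delta }. *)
Definition liminf_right0 (q : R -> R) : Rbar :=
  Rbar_lub (fun m => exists delta, 0 < delta /\
    m = Glb_Rbar (fun r => exists t, 0 < t < delta /\ r = q t)).

Definition lyapunov_derivative {X U : NormedModule R_AbsRing}
    (phi : R -> X -> (R -> U) -> X) (V : X -> R) (x : X) (d : R -> U) : Rbar :=
  liminf_right0 (fun t => / t * (V (phi t x d) - V x)).

Definition noncoercive_lyapunov {X U : NormedModule R_AbsRing} (D : U -> Prop)
    (phi : R -> X -> (R -> U) -> X) (V : X -> R) : Prop :=
  (forall x, 0 <= V x) /\
  (forall x, continuous V x) /\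
  V zero = 0 /\
  exists psi2 alpha, class_Kinf psi2 /\ class_K alpha /\
    (forall x, x <> zero -> 0 < V x /\ V x <= psi2 (norm x)) /\
    (forall x d, disturbance D d ->
       Rbar_le (lyapunov_derivative phi V x d) (Finite (- alpha (norm x)))).

Definition UGAS {X U : NormedModule R_AbsRing} (D : U -> Prop)
    (phi : R -> X -> (R -> U) -> X) : Prop :=
  exists beta, class_KL beta /\
    forall x d t, disturbance D d -> 0 <= t ->
      norm (phi t x d) <= beta (norm x) t.

(* Main.v *)
Require Import Defs.
From Stdlib Require Import Reals Lra Lia Classical ClassicalEpsilon.
From Coquelicot Require Import Coquelicot.

(** Write f(s) = V(phi(s,x,d)). Mild solutions are unique, hence phi is a
    cocycle, and the Dini inequality for V holds at every point of every
    trajectory. If |phi| >= c on [a,b], the lower right Dini derivative of f is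
    at most -alpha(c) there, so f(b) <= f(a) - alpha(c) (b - a)
    ([lyapunov_drop]); f is nonincreasing in particular. As f is nonnegative and
    f(0) <= psi2(|x|), a trajectory cannot stay far from 0 for long. Since V
    need not be bounded below in terms of the norm, this has to be combined with
    information on the flow over short times.

    - [flow_small_on_unit_interval]: if |x| <= delta1 then |phi| <= eps on [0,1],
      uniformly in d. Gronwall's inequality gives this, the reachable sets being
      bounded, g being Lipschitz on bounded sets and the semigroup being bounded
      on compact time intervals (a consequence of the Baire theorem).
    - [uniform_stability]: if |phi(t,x,d)| > eps, then |phi| >= delta1 during the
      whole unit of time before t, which costs alpha(delta1) units of V.
      A small x does not start with that much.
    - [uniform_limit]: staying above eps for a time longer than
      psi2(r) / alpha(eps) costs more V than is available in the ball of
      radius r.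
    - [uniform_attractivity] and [uniform_boundedness] follow: reach a small ball
      by [uniform_limit], then remain near 0 by [uniform_stability].

    Finally [KL_bound_exists] turns these three uniform properties into one
    KL bound, as a supremum of all trajectories against continuous cut-off
    weights. *)

Open Scope R_scope.

(** * Norms and continuity *)

(** A constant of its own, rather than [norm (minus x y)], so that terms agree
    syntactically whichever path of the algebraic hierarchy [minus] comes from. *)
Definition ndist {X : NormedModule R_AbsRing} (x y : X) : R :=
  norm (minus x y).

Lemma ndist_sym {X : NormedModule R_AbsRing} (x y : X) : ndist x y = ndist y x.
Proof. unfold ndist. now rewrite <- (norm_opp (minus x y)), opp_minus. Qed.

Lemma ndist_diag {X : NormedModule R_AbsRing} (x : X) : ndist x x = 0.
Proof. unfold ndist. rewrite minus_eq_zero. apply @norm_zero. Qed.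

Lemma ndist_zero_r {X : NormedModule R_AbsRing} (x : X) : ndist x zero = norm x.
Proof. unfold ndist. f_equal. exact (minus_zero_r x). Qed.

Lemma ndist_triangle {X : NormedModule R_AbsRing} (x y z : X) :
  ndist x z <= ndist x y + ndist y z.
Proof. unfold ndist. rewrite (minus_trans y x z). apply @norm_triangle. Qed.

Lemma norm_le_ndist {X : NormedModule R_AbsRing} (x y : X) :
  norm x <= ndist x y + norm y.
Proof. rewrite <- (ndist_zero_r x), <- (ndist_zero_r y). apply ndist_triangle. Qed.

Lemma minus_plus_r {G : AbelianGroup} (x y : G) : minus (plus x y) y = x.
Proof.
  exact (eq_trans (eq_sym (plus_assoc _ _ _))
           (eq_trans (f_equal (plus x) (plus_opp_r y)) (plus_zero_r x))).
Qed.

Lemma ndist_plus_l {X : NormedModule R_AbsRing} (x y : X) :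
  ndist (plus x y) y = norm x.
Proof. exact (f_equal norm (minus_plus_r x y)). Qed.

Lemma ndist_linear_le {X Y : NormedModule R_AbsRing} (l : X -> Y) M x y :
  is_linear l -> (forall z, norm (l z) <= M * norm z) ->
  ndist (l x) (l y) <= M * ndist x y.
Proof.
  intros hl hM.
  assert (Hopp : l (opp y) = opp (l y)).
  { exact (eq_trans (f_equal l (eq_sym (scal_opp_one y)))
             (eq_trans (linear_scal l hl _ y) (scal_opp_one (l y)))). }
  apply Rle_trans with (2 := hM (minus x y)). apply Req_le.
  unfold ndist. f_equal.
  exact (eq_trans (f_equal (plus (l x)) (eq_sym Hopp))
           (eq_sym (linear_plus l hl x (opp y)))).
Qed.

Lemma norm_scal_pos {X : NormedModule R_AbsRing} (l : R) (x : X) :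
  0 < l -> norm (scal l x) = l * norm x.
Proof.
  intros hl. apply Rle_antisym.
  - pose proof (norm_scal l x) as H. unfold abs in H; simpl in H.
    now rewrite Rabs_pos_eq in H by lra.
  - assert (E : scal (/ l) (scal l x) = x).
    { rewrite scal_assoc. transitivity (scal (one : R_AbsRing) x);
        [|exact (scal_one x)].
      f_equal. unfold mult, one; simpl. field; lra. }
    assert (H : norm x <= abs (/ l) * norm (scal l x))
      by (rewrite <- E at 1; apply @norm_scal).
    pose proof (Rinv_0_lt_compat _ hl).
    unfold abs in H; simpl in H. rewrite Rabs_pos_eq in H by lra.
    apply Rmult_le_reg_l with (/ l); [easy|].
    now replace (/ l * (l * norm x)) with (norm x) by (field; lra).
Qed.

(** Freezing a trajectory at its initial value for negative times makes it
    continuous on the whole line, where the calculus lemmas apply. *)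
Lemma continuous_on_extend {S : UniformSpace} (f : R -> S) :
  continuous_on Defs.nonneg f -> forall t, continuous (fun s => f (Rmax 0 s)) t.
Proof.
  intros hf t.
  refine (filterlim_comp _ _ _ (Rmax 0) f (locally t)
            (within Defs.nonneg (locally (Rmax 0 t))) (locally (f (Rmax 0 t))) _ _).
  2: apply hf, Rmax_l.
  intros P [e He]. exists e. intros s Hs.
  apply He; [|apply Rmax_l].
  revert Hs. unfold ball; simpl; unfold AbsRing_ball, abs, minus, plus, opp; simpl.
  intros Hs. refine (Rle_lt_trans _ _ _ _ Hs).
  unfold Rmax; destruct (Rle_dec 0 s), (Rle_dec 0 t);
    split_Rabs; lra.
Qed.

Lemma continuous_R_eps (f : R -> R) t :
  continuous f t -> forall e, 0 < e ->
  exists h, 0 < h /\ forall s, Rabs (s - t) < h -> Rabs (f s - f t) < e.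
Proof.
  intros hf e He.
  destruct (proj1 (filterlim_locally f (f t)) hf (mkposreal e He)) as [h Hh].
  exists h; split; [apply cond_pos|exact Hh].
Qed.

Lemma continuous_on_nonneg_eps (f : R -> R) :
  (forall t, 0 <= t -> forall e, 0 < e -> exists h, 0 < h /\
     forall s, 0 <= s -> Rabs (s - t) < h -> Rabs (f s - f t) < e) ->
  continuous_on Defs.nonneg f.
Proof.
  intros H t Ht. apply filterlim_locally. intros [e He].
  destruct (H t Ht e He) as [h [Hh Hc]].
  exists (mkposreal h Hh). intros s Hs H0. exact (Hc s H0 Hs).
Qed.

(** * Lower Dini derivatives *)

(** For each slope above [- k], the points at which the linear bound of that
    slope holds form a closed set; by the Dini condition, a point of it other
    than [b] has points of it to its right, so its supremum is [b]. A lower derivative suffices because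
    one good point beyond the supremum is enough. *)
Lemma lower_dini_decrease (f : R -> R) (a b k : R) :
  a <= b -> (forall s, continuous f s) ->
  (forall s, a <= s < b -> forall delta eps, 0 < delta -> 0 < eps ->
     exists h, 0 < h < delta /\ f (s + h) - f s <= (- k + eps) * h) ->
  f b <= f a - k * (b - a).
Proof.
  intros hab hf hD.
  cut (forall eps, 0 < eps -> f b <= f a + (- k + eps) * (b - a)).
  { intros H. destruct (Req_dec a b) as [->|hne].
    - specialize (H 1 Rlt_0_1); lra.
    - apply Rle_plus_epsilon. intros e He.
      assert (Hp : 0 < e / (b - a)) by (apply Rdiv_lt_0_compat; lra).
      specialize (H _ Hp).
      replace ((- k + e / (b - a)) * (b - a)) with (- k * (b - a) + e) in H
        by (field; lra). lra. }
  intros eps He.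
  set (G s := f s - (f a + (- k + eps) * (s - a))).
  assert (hG : forall s, continuous G s).
  { intros s. apply @continuous_minus. apply hf.
    apply @continuous_plus. apply @continuous_const.
    apply @continuous_mult. apply @continuous_const.
    apply @continuous_minus. apply @continuous_id. apply @continuous_const. }
  destruct (completeness (fun s => a <= s <= b /\ G s <= 0)) as [m [Hub Hlub]].
  - exists b. intros s [Hs _]; lra.
  - exists a. unfold G. lra.
  - assert (ham : a <= m) by (apply Hub; unfold G; lra).
    assert (hmb : m <= b) by (apply Hlub; intros s [Hs _]; lra).
    assert (hGm : G m <= 0).
    { apply Rnot_lt_le; intros Hpos.
      destruct (continuous_R_eps G m (hG m) _ Hpos) as [h [Hh Hc]].
      assert (m <= m - h / 2); [|lra].
      apply Hlub. intros s [Hs HGs]. apply Rnot_lt_le; intros Hlt.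
      assert (s <= m) by (apply Hub; easy).
      assert (Hd : Rabs (s - m) < h) by (split_Rabs; lra).
      specialize (Hc s Hd). split_Rabs; lra. }
    destruct (Rle_lt_or_eq_dec _ _ hmb) as [Hlt|Heq].
    + destruct (hD m (conj ham Hlt) (b - m) eps) as [h [Hh Hle]]; try lra.
      assert (m + h <= m); [|lra].
      apply Hub. split; [lra|]. unfold G in *. nra.
    + subst m. unfold G in hGm. lra.
Qed.

(** The form in which a bound on the lower limit enters [lower_dini_decrease]. *)
Lemma liminf_right0_le (q : R -> R) (l : R) :
  Rbar_le (liminf_right0 q) (Finite l) ->
  forall delta eps, 0 < delta -> 0 < eps ->
  exists t, 0 < t < delta /\ q t <= l + eps.
Proof.
  intros hle delta eps Hd He. apply NNPP; intros Hno.
  set (E := fun r => exists t, 0 < t < delta /\ r = q t).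
  assert (Hlow : Rbar_le (Finite (l + eps)) (Glb_Rbar E)).
  { apply Glb_Rbar_correct. intros r [t [Ht ->]]. simpl.
    apply Rnot_lt_le; intros Hlt. apply Hno. exists t. split; [easy|lra]. }
  assert (Hup : Rbar_le (Glb_Rbar E) (liminf_right0 q)).
  { unfold liminf_right0, Rbar_lub. destruct (Rbar_ex_lub _) as [m Hm]. simpl.
    apply (proj1 Hm). now exists delta. }
  pose proof (Rbar_le_trans _ _ _ Hlow (Rbar_le_trans _ _ _ Hup hle)) as H.
  simpl in H. lra.
Qed.

(** * Local boundedness of a C0-semigroup *)

(** Otherwise balls can be nested, the n-th one avoiding [F n], with radii
    tending to 0; their common point would lie in no [F n]. *)
Lemma baire {X : CompleteNormedModule R_AbsRing} (F : nat -> X -> Prop) :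
  (forall n x, ~ F n x -> exists r, 0 < r /\
     forall y, ndist y x < r -> ~ F n y) ->
  (forall x, exists n, F n x) ->
  exists n x r, 0 < r /\ forall y, ndist y x <= r -> F n y.
Proof.
  intros hopen hcov. apply NNPP; intros hno.
  assert (step : forall p : nat * (X * posreal), exists q : X * posreal,
    ndist (fst q) (fst (snd p)) + snd q <= snd (snd p) /\
    snd q <= snd (snd p) / 2 /\
    forall y, ndist y (fst q) <= snd q -> ~ F (fst p) y).
  { intros [n [x [r Hr]]]. simpl.
    assert (Hy : exists y, ndist y x <= r / 2 /\ ~ F n y).
    { apply NNPP; intros Hy. apply hno. exists n, x, (r / 2). split; [lra|].
      intros y Hle. apply NNPP; intros HF. apply Hy. now exists y. }
    destruct Hy as [y [Hy HF]]. destruct (hopen n y HF) as [s [Hs Hball]].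
    assert (Hm : 0 < Rmin (r / 2) (s / 2)) by (apply Rmin_glb_lt; lra).
    exists (y, mkposreal _ Hm). simpl.
    pose proof (Rmin_l (r / 2) (s / 2)). pose proof (Rmin_r (r / 2) (s / 2)).
    repeat split; try lra.
    intros z Hz. apply Hball. lra. }
  set (next p := proj1_sig (constructive_indefinite_description _ (step p))).
  assert (Hnext := fun p =>
    proj2_sig (constructive_indefinite_description _ (step p))).
  change (forall p, ndist (fst (next p)) (fst (snd p)) + snd (next p)
                      <= snd (snd p) /\
                    snd (next p) <= snd (snd p) / 2 /\
                    forall y, ndist y (fst (next p)) <= snd (next p) ->
                      ~ F (fst p) y) in Hnext.
  set (c := nat_rect (fun _ => (X * posreal)%type) (zero, mkposreal 1 Rlt_0_1)
              (fun n p => next (n, p))).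
  assert (Hc : forall n, ndist (fst (c (S n))) (fst (c n)) + snd (c (S n))
                 <= snd (c n) /\ snd (c (S n)) <= snd (c n) / 2 /\
                 forall y, ndist y (fst (c (S n))) <= snd (c (S n)) ->
                   ~ F n y).
  { intros n. exact (Hnext (n, c n)). }
  assert (Hnest : forall n k,
    ndist (fst (c (n + k)%nat)) (fst (c n)) + snd (c (n + k)%nat)
      <= snd (c n)).
  { intros n k. induction k as [|k IH].
    - rewrite Nat.add_0_r, ndist_diag. lra.
    - rewrite Nat.add_succ_r. destruct (Hc (n + k)%nat) as [H _].
      pose proof (ndist_triangle (fst (c (S (n + k)))) (fst (c (n + k)%nat))
                    (fst (c n))). lra. }
  assert (Hrad : forall n, snd (c n) <= (/ 2) ^ n).
  { intros n. induction n as [|n IH]; [simpl; lra|].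
    destruct (Hc n) as [_ [H _]]. simpl pow. lra. }
  assert (Hlim : exists y, filterlim (fun n => fst (c n)) eventually (locally y)).
  { apply (proj1 (filterlim_locally_cauchy (U := X) (F := eventually)
                    (fun n => fst (c n)))). intros [e He].
    destruct (pow_lt_1_zero (/ 2)) with (y := e / 2) as [N HN];
      [split_Rabs; lra|lra|].
    exists (fun n => (N <= n)%nat). split; [now exists N|].
    intros u v Hu Hv. apply (norm_compat1 (V := X)).
    change (ndist (fst (c v)) (fst (c u)) < e).
    pose proof (Hnest N (u - N)%nat) as Hu'. pose proof (Hnest N (v - N)%nat) as Hv'.
    replace (N + (u - N))%nat with u in Hu' by lia.
    replace (N + (v - N))%nat with v in Hv' by lia.
    pose proof (cond_pos (snd (c u))). pose proof (cond_pos (snd (c v))).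
    specialize (HN N (Nat.le_refl N)). specialize (Hrad N).
    assert ((/ 2) ^ N < e / 2) by (split_Rabs; lra).
    pose proof (ndist_triangle (fst (c v)) (fst (c N)) (fst (c u))) as H2.
    rewrite (ndist_sym (fst (c N)) (fst (c u))) in H2. lra. }
  destruct Hlim as [y Hy].
  assert (Hin : forall n, ndist y (fst (c n)) <= snd (c n)).
  { intros n. apply Rle_plus_epsilon. intros e He.
    destruct (proj1 (filterlim_locally_ball_norm _ _) Hy (mkposreal e He)) as [N HN].
    specialize (HN (n + N)%nat ltac:(lia)).
    change (ndist (fst (c (n + N)%nat)) y < e) in HN.
    rewrite ndist_sym in HN. specialize (Hnest n N).
    pose proof (cond_pos (snd (c (n + N)%nat))).
    pose proof (ndist_triangle y (fst (c (n + N)%nat)) (fst (c n))). lra. }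
  destruct (hcov y) as [n Hn].
  destruct (Hc n) as [_ [_ H]]. now apply (H y).
Qed.

(** A ball around [x0] is moved to the origin by subtracting [l x0], which
    costs the factor 2, and homogeneity does the rest. *)
Lemma linear_bound_of_ball {X Y : NormedModule R_AbsRing} (l : X -> Y)
    (x0 : X) (r N : R) :
  is_linear l -> 0 < r ->
  (forall y, ndist y x0 <= r -> norm (l y) <= N) ->
  forall x, norm (l x) <= 2 * N / r * norm x.
Proof.
  intros hl Hr Hball x.
  destruct (Rle_lt_or_eq_dec _ _ (norm_ge_0 x)) as [Hx|Hx].
  + set (w := scal (r / norm x) x : X).
    assert (Hrx : 0 < r / norm x) by (apply Rdiv_lt_0_compat; lra).
    assert (Hw : norm w = r).
    { transitivity (r / norm x * norm x); [now apply @norm_scal_pos|field; lra]. }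
    assert (H1 : norm (l (plus w x0)) <= N).
    { apply Hball; rewrite ndist_plus_l. lra. }
    assert (H2 : norm (l x0) <= N).
    { apply Hball; rewrite ndist_diag. lra. }
    rewrite (linear_plus _ hl) in H1.
    assert (H3 : norm (l w) <= 2 * N).
    { rewrite <- (ndist_plus_l (l w) (l x0)).
      pose proof (ndist_triangle (plus (l w) (l x0)) zero (l x0)) as H3.
      rewrite (ndist_sym zero), !ndist_zero_r in H3. lra. }
    assert (H4 : norm (l w) = r / norm x * norm (l x)).
    { transitivity (norm (scal (r / norm x) (l x)));
        [f_equal; apply (linear_scal _ hl)|now apply @norm_scal_pos]. }
    rewrite H4 in H3.
    apply Rmult_le_reg_l with (1 := Hrx).
    replace (r / norm x * (2 * N / r * norm x)) with (2 * N)
      by (field; lra). exact H3.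
  + destruct (linear_norm _ hl) as [M [HM Hb]]. specialize (Hb x).
    rewrite <- Hx in *. lra.
Qed.

(** Uniform boundedness principle: strong continuity at 0 bounds each orbit on
    some interval [[0, 1/(n+1)]]. So the vectors whose orbit is bounded by n on
    that interval form closed sets that cover the space, and one of these
    contains a ball. *)
Lemma semigroup_bounded_near_0 {X : CompleteNormedModule R_AbsRing}
    (T : R -> X -> X) :
  C0_semigroup T -> exists delta M, 0 < delta /\ 0 <= M /\
    forall t x, 0 <= t <= delta -> norm (T t x) <= M * norm x.
Proof.
  intros [hlin [hT0 [_ hcont]]].
  destruct (baire (fun n x => forall t, 0 <= t <= / (INR n + 1) ->
                     norm (T t x) <= INR n)) as [n [x0 [r [Hr Hball]]]].
  - intros n x HF. apply not_all_ex_not in HF. destruct HF as [t HF].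
    apply imply_to_and in HF. destruct HF as [Ht HF]. apply Rnot_le_lt in HF.
    pose proof (hlin t (proj1 Ht)) as hl. destruct (linear_norm _ hl) as [M [HM Hb]].
    exists ((norm (T t x) - INR n) / M). split; [apply Rdiv_lt_0_compat; lra|].
    intros y Hy Hn. specialize (Hn t Ht).
    pose proof (norm_le_ndist (T t x) (T t y)) as H1.
    pose proof (ndist_linear_le _ M x y hl Hb).
    rewrite ndist_sym in Hy. apply Rlt_div_r in Hy; [|easy]. lra.
  - intros x.
    destruct (proj1 (filterlim_locally_ball_norm _ _) (hcont x)
                (mkposreal 1 Rlt_0_1)) as [h Hh].
    destruct (nfloor_ex (norm x + 1 + / h)) as [n Hn].
    { pose proof (norm_ge_0 x). pose proof (Rinv_0_lt_compat _ (cond_pos h)). lra. }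
    exists (S n). rewrite S_INR. intros t Ht.
    pose proof (norm_ge_0 x). pose proof (Rinv_0_lt_compat _ (cond_pos h)).
    destruct (Req_dec t 0) as [->|Hne]; [rewrite hT0; lra|].
    assert (Hb : ndist (T t x) x < 1).
    { apply (Hh t); [|simpl in Ht; lra].
      change (Rabs (t - 0) < h).
      rewrite Rminus_0_r, Rabs_pos_eq by lra.
      apply Rle_lt_trans with (1 := proj2 Ht).
      rewrite <- (Rinv_inv h). apply Rinv_lt_contravar; [|lra].
      apply Rmult_lt_0_compat; lra. }
    pose proof (norm_le_ndist (T t x) x). lra.
  - exists (/ (INR n + 1)), (2 * INR n / r). pose proof (pos_INR n).
    split; [apply Rinv_0_lt_compat; lra|].
    split; [apply Rmult_le_pos; [lra|apply Rlt_le, Rinv_0_lt_compat, Hr]|].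
    intros t x Ht. pose proof (hlin t (proj1 Ht)) as hl.
    apply (linear_bound_of_ball (T t) x0); [easy|easy|].
    intros y Hy. now apply Hball.
Qed.

(** The semigroup law extends the bound by one step of length [h] at a time. *)
Lemma semigroup_locally_bounded {X : CompleteNormedModule R_AbsRing}
    (T : R -> X -> X) (tau : R) :
  C0_semigroup T -> exists M, 0 <= M /\
    forall t x, 0 <= t <= tau -> norm (T t x) <= M * norm x.
Proof.
  intros hT. destruct (semigroup_bounded_near_0 T hT) as [h [M [Hh [HM Hb]]]].
  assert (Hk : forall k : nat, exists M, 0 <= M /\
            forall t x, 0 <= t <= INR k * h -> norm (T t x) <= M * norm x).
  { induction k as [|k [Mk [HMk IH]]].
    - exists M. split; [easy|]. intros t x Ht. apply Hb. simpl in Ht. lra.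
    - exists (Rmax M (Mk * M)). split; [apply Rle_trans with (1 := HM), Rmax_l|].
      intros t x Ht. rewrite S_INR in Ht. pose proof (norm_ge_0 x) as Hx.
      destruct (Rle_dec t h) as [Hth|Hth].
      + apply Rle_trans with (M * norm x); [apply Hb; lra|].
        apply Rmult_le_compat_r; [easy|apply Rmax_l].
      + replace t with ((t - h) + h) by ring. destruct hT as [_ [_ [hS _]]].
        rewrite hS by lra. apply Rle_trans with (Mk * norm (T h x));
          [apply IH; lra|].
        apply Rle_trans with (Mk * M * norm x).
        * rewrite Rmult_assoc. apply Rmult_le_compat_l; [easy|]. apply Hb; lra.
        * apply Rmult_le_compat_r; [easy|apply Rmax_r]. }
  destruct (nfloor_ex (Rmax 0 tau / h)) as [n Hn].
  { apply Rmult_le_pos; [apply Rmax_l|apply Rlt_le, Rinv_0_lt_compat, Hh]. }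
  destruct (Hk (S n)) as [M' [HM' H]]. exists M'. split; [easy|].
  intros t x Ht. apply H. rewrite S_INR.
  pose proof (Rmax_r 0 tau).
  assert (Rmax 0 tau <= (INR n + 1) * h) by (apply Rle_div_l; lra). lra.
Qed.

(** * Mild solutions *)

Lemma plus_minus_cancel {G : AbelianGroup} (x y : G) : plus (minus x y) y = x.
Proof.
  exact (eq_trans (eq_sym (plus_assoc _ _ _))
           (eq_trans (f_equal (plus x) (plus_opp_l y)) (plus_zero_r x))).
Qed.

Lemma ndist_eq_0 {X : NormedModule R_AbsRing} (x y : X) :
  ndist x y <= 0 -> x = y.
Proof.
  intros H. rewrite <- (plus_minus_cancel x y).
  assert (E : minus x y = zero).
  { apply norm_eq_zero. apply Rle_antisym; [exact H|apply norm_ge_0]. }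
  exact (eq_trans (f_equal (fun z => plus z y) E) (plus_zero_l y)).
Qed.

Lemma plus_interchange {G : AbelianMonoid} (a b c d : G) :
  plus (plus a b) (plus c d) = plus (plus a c) (plus b d).
Proof.
  rewrite <- !plus_assoc. f_equal. rewrite !plus_assoc. f_equal. apply plus_comm.
Qed.

Lemma ndist_plus {X : NormedModule R_AbsRing} (a b c d : X) :
  ndist (plus a b) (plus c d) <= ndist a c + norm (minus b d).
Proof.
  apply Rle_trans with (2 := norm_triangle (minus a c) (minus b d)).
  apply Req_le. unfold ndist. f_equal.
  exact (eq_trans (f_equal (plus _) (opp_plus c d)) (plus_interchange _ _ _ _)).
Qed.

Lemma continuous_ndist {X : NormedModule R_AbsRing} (f g : R -> X) t :
  continuous f t -> continuous g t -> continuous (fun s => ndist (f s) (g s)) t.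
Proof.
  intros hf hg.
  apply (continuous_comp (fun s => minus (f s) (g s)) (@norm _ X)).
  - now apply (continuous_minus (V := X)).
  - apply filterlim_norm.
Qed.

Lemma linear_zero {X Y : NormedModule R_AbsRing} (l : X -> Y) :
  is_linear l -> l zero = zero.
Proof.
  intros hl.
  exact (eq_trans (f_equal l (eq_sym (scal_zero_l zero)))
           (eq_trans (linear_scal l hl _ _) (scal_zero_l _))).
Qed.

(** A bounded operator commutes with Riemann sums and is continuous. *)
Lemma is_RInt_linear {X Y : NormedModule R_AbsRing} (l : X -> Y) f a b I :
  is_linear l -> is_RInt f a b I -> is_RInt (fun s => l (f s)) a b (l I).
Proof.
  intros hl hf. unfold is_RInt.
  assert (Hsum : forall ptd,
             Riemann_sum (fun s => l (f s)) ptd = l (Riemann_sum f ptd)).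
  { intros ptd. induction ptd as [h|h s IH] using SF_cons_ind.
    - symmetry. exact (linear_zero l hl).
    - rewrite !Riemann_sum_cons. rewrite IH. symmetry.
      exact (eq_trans (linear_plus l hl _ _)
               (f_equal (fun z => plus z _) (linear_scal l hl _ _))). }
  apply (filterlim_ext (fun ptd => l (scal (sign (b - a)) (Riemann_sum f ptd)))).
  - intros ptd. rewrite Hsum. exact (linear_scal l hl _ _).
  - refine (filterlim_comp _ _ _ _ l _ _ _ hf _). now apply linear_cont.
Qed.

(** [w] below is nonincreasing, because its derivative has the sign of
    [u - (a + b * RInt u 0 s)]. *)
Lemma gronwall (u : R -> R) (a b tau : R) :
  0 <= b -> (forall s, continuous u s) ->
  (forall t, 0 <= t <= tau -> u t <= a + b * RInt u 0 t) ->
  forall t, 0 <= t <= tau -> u t <= a * exp (b * t).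
Proof.
  intros hb hu hle t Ht.
  set (w s := exp (- b * s) * (a + b * RInt u 0 s)).
  assert (Hw : forall s,
            is_derive w s (exp (- b * s) * b * (u s - (a + b * RInt u 0 s)))).
  { intros s. unfold w. auto_derive.
    - split; [|split; [|easy]].
      + apply (ex_RInt_continuous (V := R_CompleteNormedModule)).
        intros z _. apply hu.
      + apply filter_forall. intros r. apply continuity_pt_filterlim, hu.
    - replace (RInt (fun x => u x) 0 s) with (RInt u 0 s) by reflexivity. ring. }
  destruct (MVT_gen w 0 t _ (fun s _ => Hw s)) as [c [Hc E]].
  { intros s _. apply derivable_continuous_pt.
    exists (exp (- b * s) * b * (u s - (a + b * RInt u 0 s))).
    apply is_derive_Reals, Hw. }
  rewrite Rmin_left, Rmax_right in Hc by lra.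
  assert (Hle : w t <= a).
  { replace a with (w 0).
    2: { unfold w. rewrite RInt_point, Rmult_0_r, exp_0. unfold zero; simpl. ring. }
    specialize (hle c ltac:(lra)). pose proof (exp_pos (- b * c)).
    assert (0 <= exp (- b * c) * b * t * (a + b * RInt u 0 c - u c)); [|nra].
    repeat apply Rmult_le_pos; lra. }
  apply Rle_trans with (1 := hle t Ht).
  replace (a + b * RInt u 0 t) with (w t * exp (b * t)).
  - apply Rmult_le_compat_r; [apply Rlt_le, exp_pos|exact Hle].
  - unfold w. rewrite (Rmult_comm (exp _)), Rmult_assoc, <- exp_plus.
    replace (- b * t + b * t) with 0 by ring. rewrite exp_0. ring.
Qed.

Section Mild.
Context {X : CompleteNormedModule R_AbsRing} {U : NormedModule R_AbsRing}.
Context (T : R -> X -> X) (D : U -> Prop) (g : X -> U -> X).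
Context (hT : C0_semigroup T) (hLip : lipschitz_on_balls D g).

Lemma mild_solution_continuous x0 d x :
  mild_solution T g x0 d x -> forall t, continuous (fun s => x (Rmax 0 s)) t.
Proof. intros [hx _]. now apply (continuous_on_extend (S := X)). Qed.

Lemma mild_solution_bounded x0 d x tau :
  mild_solution T g x0 d x ->
  exists C, 0 < C /\ forall t, 0 <= t <= tau -> norm (x t) <= C.
Proof.
  intros hx.
  destruct (bounded_continuity (V := X) (fun s => x (Rmax 0 s)) 0 tau) as [C HC].
  { intros s _. exact (mild_solution_continuous _ _ _ hx s). }
  exists (Rmax C 1). split; [apply Rlt_le_trans with (1 := Rlt_0_1), Rmax_r|].
  intros t Ht. specialize (HC t Ht). rewrite Rmax_right in HC by lra.
  pose proof (Rmax_l C 1). lra.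
Qed.

(** Subtracting the two integral equations and using the bounds on the semigroup
    and the Lipschitz constant of [g] on the ball of radius [C] gives the
    hypothesis of [gronwall]. The constant depends on neither the disturbance
    nor the solutions, which makes everything below uniform. *)
Lemma mild_solutions_close C tau : 0 < C -> exists K, 0 <= K /\
  forall x0 y0 d x y, (forall t, 0 <= t -> D (d t)) ->
    mild_solution T g x0 d x -> mild_solution T g y0 d y ->
    (forall t, 0 <= t <= tau -> norm (x t) <= C /\ norm (y t) <= C) ->
    forall t, 0 <= t <= tau -> ndist (x t) (y t) <= K * ndist x0 y0.
Proof.
  intros hC. destruct (hLip C hC) as [L [HL Hg]].
  destruct (semigroup_locally_bounded T tau hT) as [M [HM HTM]].
  exists (M * exp (M * L * tau)).
  split; [apply Rmult_le_pos; [easy|apply Rlt_le, exp_pos]|].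
  intros x0 y0 d x y hd hx hy hC' t Ht.
  assert (Hn0 : 0 <= ndist x0 y0) by apply norm_ge_0.
  pose proof (Rmult_le_pos M L HM (Rlt_le _ _ HL)) as HML.
  set (u s := ndist (x (Rmax 0 s)) (y (Rmax 0 s))).
  assert (hu : forall s, continuous u s).
  { intros s. apply (continuous_ndist (X := X)).
    - apply (mild_solution_continuous _ _ _ hx).
    - apply (mild_solution_continuous _ _ _ hy). }
  assert (Hgr : forall r, 0 <= r <= tau ->
            u r <= M * ndist x0 y0 + M * L * RInt u 0 r).
  { intros r Hr. destruct (proj2 hx r (proj1 Hr)) as [Ix Ex].
    destruct (proj2 hy r (proj1 Hr)) as [Iy Ey].
    unfold u at 1. rewrite Rmax_right by lra. rewrite Ex, Ey.
    apply Rle_trans with (1 := ndist_plus (X := X) _ _ _ _).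
    apply Rplus_le_compat.
    - apply ndist_linear_le; [apply hT; lra|]. intros z. now apply HTM.
    - apply (norm_RInt_le (V := X)
        (fun s => minus (T (r - s) (g (x s) (d s))) (T (r - s) (g (y s) (d s))))
        (fun s => M * L * u s) 0 r); [lra| | |].
      + intros s Hs.
        assert (Hrs : 0 <= r - s <= tau) by lra.
        apply Rle_trans with (M * ndist (g (x s) (d s)) (g (y s) (d s))).
        * apply (ndist_linear_le (X := X) (Y := X) (T (r - s)));
            [apply hT; lra|].
          intros z. now apply HTM.
        * rewrite Rmult_assoc. apply Rmult_le_compat_l; [easy|].
          unfold u. rewrite Rmax_right by lra.
          apply Hg; [apply hC'; lra|apply hC'; lra|apply hd; lra].
      + apply (is_RInt_minus (V := X)); apply (RInt_correct (V := X)); easy.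
      + apply (is_RInt_scal (V := R_NormedModule)).
        apply (RInt_correct (V := R_CompleteNormedModule)).
        apply ex_RInt_continuous. intros z _. apply hu. }
  pose proof (gronwall u _ _ tau HML hu Hgr t Ht) as H.
  unfold u in H. rewrite Rmax_right in H by lra.
  apply Rle_trans with (1 := H).
  replace (M * exp (M * L * tau) * ndist x0 y0)
    with (M * ndist x0 y0 * exp (M * L * tau)) by ring.
  apply Rmult_le_compat_l; [now apply Rmult_le_pos|].
  assert (M * L * t <= M * L * tau) as [Hlt|Heq]
    by (apply Rmult_le_compat_l; lra).
  - apply Rlt_le, exp_increasing, Hlt.
  - rewrite Heq. apply Rle_refl.
Qed.

Lemma mild_solution_unique x0 d x y :
  (forall t, 0 <= t -> D (d t)) ->
  mild_solution T g x0 d x -> mild_solution T g x0 d y ->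
  forall t, 0 <= t -> x t = y t.
Proof.
  intros hd hx hy t Ht.
  destruct (mild_solution_bounded _ _ _ t hx) as [Cx [HCx Hx]].
  destruct (mild_solution_bounded _ _ _ t hy) as [Cy [HCy Hy]].
  destruct (mild_solutions_close (Cx + Cy) t) as [K [_ HK]]; [lra|].
  apply (ndist_eq_0 (X := X)).
  apply Rle_trans with (K * ndist x0 x0); [|rewrite ndist_diag; lra].
  apply (HK x0 x0 d x y hd hx hy); [|lra].
  intros s Hs. specialize (Hx s Hs). specialize (Hy s Hs). lra.
Qed.

Lemma filterlim_shift_within a t : 0 <= a ->
  filterlim (fun s => a + s) (within Defs.nonneg (locally t))
    (within Defs.nonneg (locally (a + t))).
Proof.
  intros Ha P [e He]. exists e. intros s Hs H0. apply He.
  - change (Rabs (a + s - (a + t)) < e). change (Rabs (s - t) < e) in Hs.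
    now replace (a + s - (a + t)) with (s - t) by ring.
  - unfold Defs.nonneg in *. lra.
Qed.

(** Split the integral over [[0, a + t]] at [a]: the semigroup law takes [T t] out
    of the first part, and translation by [a] brings the second to [[0, t]]. *)
Lemma mild_solution_restart x0 d x a : 0 <= a ->
  mild_solution T g x0 d x ->
  mild_solution T g (x a) (fun s => d (a + s)) (fun s => x (a + s)).
Proof.
  intros Ha [hc hx]. destruct hT as [hlin [_ [hS _]]]. split.
  { intros t Ht.
    apply (filterlim_comp _ _ _ _ x _ _ _ (filterlim_shift_within a t Ha)).
    apply hc. unfold Defs.nonneg in *. lra. }
  intros t Ht.
  destruct (hx a Ha) as [Ia Ea]. destruct (hx (a + t) ltac:(lra)) as [It Et].
  set (F := fun s => T (a + t - s) (g (x s) (d s))) in *.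
  assert (I1 : is_RInt F 0 a (T t (RInt (fun s => T (a - s) (g (x s) (d s))) 0 a))).
  { apply (is_RInt_ext (V := X) (fun s => T t (T (a - s) (g (x s) (d s))))).
    - intros s Hs. rewrite Rmin_left, Rmax_right in Hs by lra.
      unfold F. rewrite <- hS by lra. f_equal. ring.
    - apply (is_RInt_linear (X := X)); [now apply hlin|].
      now apply (RInt_correct (V := X)). }
  assert (I2 : ex_RInt F a (a + t))
    by (apply (ex_RInt_Chasles_2 (V := X)) with 0; [lra|easy]).
  assert (I3 : is_RInt (fun s => T (t - s) (g (x (a + s)) (d (a + s)))) 0 t
                 (RInt F a (a + t))).
  { apply (is_RInt_ext (V := X) (fun s => scal 1 (F (1 * s + a)))).
    - intros s Hs.
      transitivity (F (1 * s + a)); [exact (scal_one (F (1 * s + a)))|].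
      unfold F. replace (1 * s + a) with (a + s) by ring.
      f_equal. ring.
    - apply (is_RInt_comp_lin (V := X)).
      replace (1 * 0 + a) with a by ring. replace (1 * t + a) with (a + t) by ring.
      now apply (RInt_correct (V := X)). }
  split; [now exists (RInt F a (a + t))|].
  rewrite (is_RInt_unique (V := X) _ _ _ _ I3).
  rewrite Et, <- (RInt_Chasles (V := X) F 0 a (a + t));
    [|now exists (T t (RInt (fun s => T (a - s) (g (x s) (d s))) 0 a))|easy].
  rewrite (is_RInt_unique (V := X) _ _ _ _ I1).
  rewrite (Rplus_comm a t), hS by lra. rewrite Ea.
  pose proof (linear_plus _ (hlin t Ht) (T a x0)
                (RInt (fun s => T (a - s) (g (x s) (d s))) 0 a)) as Hp.
  etransitivity; [apply (plus_assoc (G := X))|].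
  exact (f_equal (fun z => plus z _) (eq_sym Hp)).
Qed.

End Mild.

Lemma disturbance_shift {U : NormedModule R_AbsRing} (D : U -> Prop) d a :
  0 <= a -> disturbance D d -> disturbance D (fun s => d (a + s)).
Proof.
  intros Ha [hD [[M hM] [h1 [h2 h3]]]]. split; [|split; [|split; [|split]]].
  - intros t Ht. apply hD. lra.
  - exists M. intros t Ht. apply hM. lra.
  - intros tau Htau. destruct (h1 (a + tau) ltac:(lra)) as [l Hl].
    (* Translated discontinuities; negative ones are harmless. *)
    exists (List.map (fun s => s - a) l). intros t Ht Hin.
    refine (filterlim_comp _ _ _ _ d _ _ _ (filterlim_shift_within a t Ha) _).
    apply Hl; [lra|]. intros Hin'. apply Hin.
    replace t with (a + t - a) by ring. now apply (List.in_map (fun s => s - a)).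
  - intros t Ht. destruct (h2 (a + t) ltac:(lra)) as [u Hu]. exists u.
    refine (filterlim_comp _ _ _ _ d _ _ _ _ Hu).
    intros P [e He]. exists e. intros s Hs H0. apply He; [|lra].
    change (Rabs (a + s - (a + t)) < e). change (Rabs (s - t) < e) in Hs.
    now replace (a + s - (a + t)) with (s - t) by ring.
  - intros t Ht. destruct (h3 (a + t) ltac:(lra)) as [u Hu]. exists u.
    refine (filterlim_comp _ _ _ _ d _ _ _ _ Hu).
    intros P [e He]. exists e. intros s Hs H0. apply He; [|lra].
    change (Rabs (a + s - (a + t)) < e). change (Rabs (s - t) < e) in Hs.
    now replace (a + s - (a + t)) with (s - t) by ring.
Qed.

Lemma disturbance_const {U : NormedModule R_AbsRing} (D : U -> Prop) u :
  D u -> disturbance D (fun _ => u).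
Proof.
  intros hu. split; [|split; [|split; [|split]]].
  - easy.
  - exists (norm u). intros; lra.
  - intros tau _. exists nil. intros t _ _. apply filterlim_const.
  - intros t _. exists u. apply filterlim_const.
  - intros t _. exists u. apply filterlim_const.
Qed.

Lemma class_K_le gamma s t : class_K gamma -> 0 <= s -> s <= t -> gamma s <= gamma t.
Proof.
  intros [_ [H _]] Hs [Hlt| ->]; [apply Rlt_le; now apply H|apply Rle_refl].
Qed.

Lemma class_K_pos gamma s : class_K gamma -> 0 < s -> 0 < gamma s.
Proof. intros [_ [H E]] Hs. rewrite <- E. apply H; lra. Qed.

Lemma class_K_small gamma eps : class_K gamma -> 0 < eps ->
  exists delta, 0 < delta /\ forall r, 0 <= r <= delta -> gamma r <= eps.
Proof.
  intros [H [_ E]] He.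
  destruct (proj1 (filterlim_locally _ _) (H 0 (Rle_refl 0)) (mkposreal eps He))
    as [h Hh].
  pose proof (cond_pos h) as Hpos.
  exists (h / 2). split; [lra|]. intros r Hr.
  assert (Hb : Rabs (gamma r - gamma 0) < eps).
  { apply (Hh r); [|apply Hr]. change (Rabs (r - 0) < h). split_Rabs; lra. }
  rewrite E in Hb. split_Rabs; lra.
Qed.

(** * Comparison functions from uniform stability and attractivity *)

Definition clamp (u : R) : R := Rmax 0 (Rmin 1 u).

Lemma clamp_bounds u : 0 <= clamp u <= 1.
Proof. unfold clamp, Rmax, Rmin. repeat destruct Rle_dec; lra. Qed.

Lemma clamp_mono u v : u <= v -> clamp u <= clamp v.
Proof. unfold clamp, Rmax, Rmin. repeat destruct Rle_dec; lra. Qed.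

Lemma clamp_lipschitz u v : clamp u <= clamp v + Rabs (u - v).
Proof. unfold clamp, Rmax, Rmin. repeat destruct Rle_dec; split_Rabs; lra. Qed.

Lemma clamp_0 u : u <= 0 -> clamp u = 0.
Proof. unfold clamp, Rmax, Rmin. repeat destruct Rle_dec; lra. Qed.

Lemma clamp_1 u : 1 <= u -> clamp u = 1.
Proof. unfold clamp, Rmax, Rmin. repeat destruct Rle_dec; lra. Qed.

Lemma mult_clamp_bounds a B u : 0 <= a <= B -> 0 <= a * clamp u <= B.
Proof.
  intros Ha. pose proof (clamp_bounds u) as Hu. split.
  - apply Rmult_le_pos; lra.
  - apply Rle_trans with (a * 1); [apply Rmult_le_compat_l|]; lra.
Qed.

Lemma Lub_Rbar_bounded (E : R -> Prop) y B :
  E y -> (forall z, E z -> z <= B) -> is_lub E (real (Lub_Rbar E)).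
Proof.
  intros HE HB. destruct (Lub_Rbar_correct E) as [Hub Hlub].
  destruct (Lub_Rbar E) as [l| |].
  - split; [exact Hub|]. intros b Hb. exact (Hlub (Finite b) Hb).
  - destruct (Hlub (Finite B)); exact HB.
  - destruct (Hub y HE).
Qed.

(** [f i t] stands for the norm at time [t] of the trajectory [i], whose initial
    state has norm [n i]. *)
Section KL_bound.
Context (Idx : Type) (n : Idx -> R) (f : Idx -> R -> R) (i0 : Idx).
Context (n_pos : forall i, 0 <= n i).
Context (f_pos : forall i t, 0 <= t -> 0 <= f i t).
Context (stable : forall eps, 0 < eps -> exists delta, 0 < delta /\
  forall i t, n i <= delta -> 0 <= t -> f i t <= eps).
Context (bounded : forall r, exists B, 0 <= B /\
  forall i t, n i <= r -> 0 <= t -> f i t <= B).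
Context (attractive : forall r eps, 0 < eps -> exists tau,
  forall i t, n i <= r -> 0 <= t -> tau <= t -> f i t <= eps).

(** The first weight is 1 for [n i <= r] and vanishes for [2 * r <= n i]; the
    second is 1 for [t <= s] and vanishes for [s <= t - 1]. Both are monotone and
    Lipschitz in [r] and [t], so their supremum inherits from them the
    monotonicity and continuity that the supremum over
    [n i <= r] and [t <= s] may lack, and it is still controlled by the
    trajectories with [n i <= 2 * r] after time [t - 1]. *)
Let weighted (r t : R) (i : Idx) (s : R) : R :=
  f i s * clamp (2 - n i / r) * clamp (1 + s - t).

Let envelope (r t : R) : R :=
  real (Lub_Rbar (fun y => exists i s, 0 <= s /\ y = weighted r t i s)).

Lemma weighted_zero_or_le r t i s : 0 < r -> 0 <= s -> 0 <= weighted r t i s /\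
  (weighted r t i s = 0 \/ (n i <= 2 * r /\ t - 1 <= s /\ weighted r t i s <= f i s)).
Proof.
  intros Hr Hs. unfold weighted.
  pose proof (clamp_bounds (2 - n i / r)) as H1.
  pose proof (clamp_bounds (1 + s - t)) as H2.
  pose proof (f_pos i s Hs) as H3.
  split; [repeat apply Rmult_le_pos; lra|].
  destruct (Rle_dec (n i) (2 * r)) as [Hn|Hn].
  - destruct (Rle_dec (t - 1) s) as [Ht|Ht].
    + right. repeat split; try easy.
      rewrite Rmult_assoc. rewrite <- (Rmult_1_r (f i s)) at 2.
      apply Rmult_le_compat_l; [easy|].
      pose proof (Rmult_le_compat _ _ _ _ (proj1 H1) (proj1 H2) (proj2 H1) (proj2 H2)).
      lra.
    + left. rewrite (clamp_0 (1 + s - t)) by lra. ring.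
  - left. rewrite (clamp_0 (2 - n i / r)); [ring|].
    assert (2 < n i / r) by (apply Rlt_div_r; lra). lra.
Qed.

Lemma envelope_lub r t : 0 < r ->
  is_lub (fun y => exists i s, 0 <= s /\ y = weighted r t i s) (envelope r t).
Proof.
  intros Hr. destruct (bounded (2 * r)) as [B [HB Hb]].
  apply Lub_Rbar_bounded with (y := weighted r t i0 0) (B := B).
  - exists i0, 0. split; [lra|easy].
  - intros z [i [s [Hs ->]]].
    destruct (weighted_zero_or_le r t i s Hr Hs) as [_ [->|[Hn [_ Hq]]]]; [easy|].
    specialize (Hb i s Hn Hs). lra.
Qed.

Lemma weighted_le_envelope r t i s :
  0 < r -> 0 <= s -> weighted r t i s <= envelope r t.
Proof. intros Hr Hs. apply envelope_lub; [easy|]. now exists i, s. Qed.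

Lemma envelope_nonneg r t : 0 < r -> 0 <= envelope r t.
Proof.
  intros Hr. apply Rle_trans with (weighted r t i0 0).
  - apply weighted_zero_or_le; lra.
  - apply weighted_le_envelope; lra.
Qed.

(** All smallness of the envelope, near [r = 0] as well as for large [t], comes
    from the trajectories through this lemma. *)
Lemma envelope_le_of_tail r t b : 0 < r -> 0 <= b ->
  (forall i s, n i <= 2 * r -> 0 <= s -> t - 1 <= s -> f i s <= b) -> envelope r t <= b.
Proof.
  intros Hr Hb H. apply (envelope_lub r t Hr). intros z [i [s [Hs ->]]].
  destruct (weighted_zero_or_le r t i s Hr Hs) as [_ [->|[Hn [Ht Hq]]]]; [easy|].
  specialize (H i s Hn Hs Ht). lra.
Qed.

Lemma envelope_le_of_weighted r t r' t' c : 0 < r -> 0 < r' ->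
  (forall i s, 0 <= s -> weighted r t i s <= weighted r' t' i s + c) ->
  envelope r t <= envelope r' t' + c.
Proof.
  intros Hr Hr' H. apply (envelope_lub r t Hr). intros z [i [s [Hs ->]]].
  apply Rle_trans with (1 := H i s Hs).
  pose proof (weighted_le_envelope r' t' i s Hr' Hs). lra.
Qed.

Lemma envelope_mono_r r r' t : 0 < r -> r <= r' -> envelope r t <= envelope r' t.
Proof.
  intros Hr Hle. rewrite <- (Rplus_0_r (envelope r' t)).
  apply envelope_le_of_weighted; try lra.
  intros i s Hs. rewrite Rplus_0_r. unfold weighted.
  apply Rmult_le_compat_r; [apply clamp_bounds|].
  apply Rmult_le_compat_l; [now apply f_pos|]. apply clamp_mono.
  assert (n i / r' <= n i / r); [|lra].
  apply Rmult_le_compat_l; [apply n_pos|]. apply Rinv_le_contravar; lra.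
Qed.

Lemma envelope_anti_t r t t' : 0 < r -> t <= t' -> envelope r t' <= envelope r t.
Proof.
  intros Hr Hle. rewrite <- (Rplus_0_r (envelope r t)).
  apply envelope_le_of_weighted; try lra.
  intros i s Hs. rewrite Rplus_0_r. unfold weighted.
  apply Rmult_le_compat_l.
  - apply Rmult_le_pos; [now apply f_pos|apply clamp_bounds].
  - apply clamp_mono. lra.
Qed.

Lemma envelope_lipschitz_t r : 0 < r -> exists L, 0 <= L /\
  forall t t', envelope r t <= envelope r t' + L * Rabs (t - t').
Proof.
  intros Hr. destruct (bounded (2 * r)) as [B [HB Hb]]. exists B. split; [easy|].
  intros t t'. apply envelope_le_of_weighted; try easy. intros i s Hs.
  pose proof (Rmult_le_pos _ _ HB (Rabs_pos (t - t'))) as HBt.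
  destruct (weighted_zero_or_le r t i s Hr Hs) as [_ [->|[Hn [_ _]]]].
  - destruct (weighted_zero_or_le r t' i s Hr Hs) as [H _]. lra.
  - unfold weighted. specialize (Hb i s Hn Hs). pose proof (f_pos i s Hs) as Hf.
    pose proof (clamp_bounds (2 - n i / r)) as Hc.
    pose proof (clamp_lipschitz (1 + s - t) (1 + s - t')) as Hl.
    replace (1 + s - t - (1 + s - t')) with (- (t - t')) in Hl by ring.
    rewrite Rabs_Ropp in Hl.
    set (w := f i s * clamp (2 - n i / r)).
    assert (0 <= w <= B) by (apply mult_clamp_bounds; lra).
    pose proof (Rabs_pos (t - t')). nra.
Qed.

Lemma envelope_lipschitz_r a b : 0 < a -> exists L, 0 <= L /\
  forall r r' t, a <= r <= b -> a <= r' <= b ->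
  envelope r t <= envelope r' t + L * Rabs (r - r').
Proof.
  intros Ha. destruct (bounded (2 * Rmax 0 b)) as [B [HB Hb]].
  pose proof (Rmax_l 0 b) as Hb0.
  exists (B * (2 * Rmax 0 b / (a * a))).
  assert (Haa : 0 < a * a) by nra.
  assert (HL : 0 <= 2 * Rmax 0 b / (a * a)).
  { apply Rmult_le_pos; [lra|]. apply Rlt_le, Rinv_0_lt_compat, Haa. }
  split; [now apply Rmult_le_pos|].
  intros r r' t Hr Hr'. apply envelope_le_of_weighted; try lra. intros i s Hs.
  pose proof (Rabs_pos (r - r')) as Hab.
  pose proof (Rmult_le_pos _ _ (Rmult_le_pos _ _ HB HL) Hab) as Hpos.
  destruct (weighted_zero_or_le r t i s ltac:(lra) Hs) as [_ [->|[Hn [_ _]]]].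
  - destruct (weighted_zero_or_le r' t i s ltac:(lra) Hs) as [H _]. lra.
  - rewrite Rmax_right in * by lra.
    specialize (Hb i s ltac:(lra) Hs). pose proof (f_pos i s Hs) as Hf.
    pose proof (clamp_bounds (1 + s - t)) as Hc.
    pose proof (clamp_lipschitz (2 - n i / r) (2 - n i / r')) as Hl.
    assert (Hd : Rabs (2 - n i / r - (2 - n i / r')) <=
                 2 * b / (a * a) * Rabs (r - r')).
    { replace (2 - n i / r - (2 - n i / r')) with (n i / (r * r') * (r - r'))
        by (field; lra).
      rewrite Rabs_mult. apply Rmult_le_compat_r; [easy|].
      assert (0 < r * r') by nra. pose proof (n_pos i).
      rewrite Rabs_pos_eq
        by (apply Rmult_le_pos; [easy|now apply Rlt_le, Rinv_0_lt_compat]).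
      apply Rmult_le_compat; [easy| |lra|apply Rinv_le_contravar; nra].
      now apply Rlt_le, Rinv_0_lt_compat. }
    unfold weighted. set (v := 2 * b / (a * a) * Rabs (r - r')) in *.
    replace (B * (2 * b / (a * a)) * Rabs (r - r')) with (B * v)
      by (unfold v; ring).
    assert (Hv : 0 <= v) by (apply Rle_trans with (2 := Hd), Rabs_pos).
    set (w := f i s * clamp (1 + s - t)).
    assert (0 <= w <= B) by (apply mult_clamp_bounds; lra).
    replace (f i s * clamp (2 - n i / r) * clamp (1 + s - t))
      with (w * clamp (2 - n i / r)) by (unfold w; ring).
    replace (f i s * clamp (2 - n i / r') * clamp (1 + s - t))
      with (w * clamp (2 - n i / r')) by (unfold w; ring).
    nra.
Qed.

(** The summand [r / (1 + t)] makes the bound strictly increasing in [r]. *)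
Let beta (r t : R) : R := (if Rlt_dec 0 r then envelope r t else 0) + r / (1 + t).

Lemma beta_at_0 t : beta 0 t = 0.
Proof. unfold beta. destruct (Rlt_dec 0 0); [lra|]. unfold Rdiv. ring. Qed.

Lemma beta_pos r t : 0 < r -> beta r t = envelope r t + r / (1 + t).
Proof. intros Hr. unfold beta. destruct (Rlt_dec 0 r); [easy|lra]. Qed.

Lemma div_le_self r t : 0 <= r -> 0 <= t -> 0 <= r / (1 + t) <= r.
Proof.
  intros Hr Ht. split.
  - apply Rmult_le_pos; [easy|]. apply Rlt_le, Rinv_0_lt_compat. lra.
  - apply Rle_div_l; nra.
Qed.

(** For [r > 0] continuity comes from [envelope_lipschitz_r] on
    [[r / 2, 2 * r]], at [r = 0] from uniform stability. *)
Lemma beta_class_K t : 0 <= t -> class_K (fun r => beta r t).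
Proof.
  intros Ht. split; [|split; [|apply beta_at_0]].
  - apply continuous_on_nonneg_eps. intros r Hr e He.
    destruct (Rle_lt_or_eq_dec _ _ Hr) as [Hpos|<-].
    + destruct (envelope_lipschitz_r (r / 2) (2 * r)) as [L [HL Hlip]]; [lra|].
      assert (Hd : 0 < e / (L + 1)) by (apply Rdiv_lt_0_compat; lra).
      exists (Rmin (r / 2) (e / (L + 1))). split; [apply Rmin_glb_lt; lra|].
      intros s _ Hs. pose proof (Rmin_l (r / 2) (e / (L + 1))).
      pose proof (Rmin_r (r / 2) (e / (L + 1))).
      assert (Hs2 : r / 2 <= s <= 2 * r) by (split_Rabs; lra).
      rewrite !beta_pos by lra.
      pose proof (Hlip s r t Hs2 ltac:(lra)) as H1.
      pose proof (Hlip r s t ltac:(lra) Hs2) as H2.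
      rewrite (Rabs_minus_sym r s) in H2.
      assert (H3 : Rabs (s / (1 + t) - r / (1 + t)) <= Rabs (s - r)).
      { replace (s / (1 + t) - r / (1 + t)) with ((s - r) / (1 + t)) by (field; lra).
        unfold Rdiv. rewrite Rabs_mult. rewrite (Rabs_pos_eq (/ (1 + t))).
        - apply div_le_self; [apply Rabs_pos|easy].
        - apply Rlt_le, Rinv_0_lt_compat. lra. }
      assert (H4 : (L + 1) * Rabs (s - r) < e).
      { rewrite Rmult_comm. apply Rlt_div_r; lra. }
      split_Rabs; lra.
    + destruct (stable (e / 2)) as [delta [Hdelta Hst]]; [lra|].
      exists (Rmin (delta / 2) (e / 2)). split; [apply Rmin_glb_lt; lra|].
      intros s Hs0 Hs. rewrite beta_at_0. rewrite !Rminus_0_r in *.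
      pose proof (Rmin_l (delta / 2) (e / 2)). pose proof (Rmin_r (delta / 2) (e / 2)).
      rewrite Rabs_pos_eq in Hs by easy.
      destruct (Rle_lt_or_eq_dec _ _ Hs0) as [Hpos|<-];
        [|rewrite beta_at_0, Rabs_R0; easy].
      rewrite beta_pos by easy.
      assert (envelope s t <= e / 2).
      { apply envelope_le_of_tail; [easy|lra|]. intros i u Hn Hu _. apply Hst; lra. }
      pose proof (envelope_nonneg s t Hpos). pose proof (div_le_self s t Hs0 Ht).
      rewrite Rabs_pos_eq by lra. lra.
  - intros r r' Hr Hlt.
    assert (Hdiv : r / (1 + t) < r' / (1 + t)).
    { apply Rmult_lt_compat_r; [apply Rinv_0_lt_compat; lra|easy]. }
    rewrite (beta_pos r') by lra.
    destruct (Rle_lt_or_eq_dec _ _ Hr) as [Hpos|<-].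
    + rewrite beta_pos by easy.
      pose proof (envelope_mono_r r r' t Hpos ltac:(lra)). lra.
    + rewrite beta_at_0. pose proof (envelope_nonneg r' t Hlt).
      unfold Rdiv in Hdiv at 1. lra.
Qed.

Lemma beta_class_L r : 0 < r -> class_L (fun t => beta r t).
Proof.
  intros Hr. split; [|split; [|split]].
  - apply continuous_on_nonneg_eps. intros t Ht e He.
    destruct (envelope_lipschitz_t r Hr) as [L [HL Hlip]].
    exists (e / (L + r)). split; [apply Rdiv_lt_0_compat; lra|].
    intros s Hs0 Hs. rewrite !beta_pos by easy.
    pose proof (Hlip s t) as H1. pose proof (Hlip t s) as H2.
    rewrite (Rabs_minus_sym t s) in H2.
    assert (H3 : Rabs (r / (1 + s) - r / (1 + t)) <= r * Rabs (s - t)).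
    { replace (r / (1 + s) - r / (1 + t))
        with (r * ((t - s) / ((1 + t) * (1 + s)))) by (field; lra).
      rewrite Rabs_mult, Rabs_pos_eq by lra. apply Rmult_le_compat_l; [lra|].
      unfold Rdiv. rewrite Rabs_mult, (Rabs_minus_sym t s).
      assert (1 <= (1 + t) * (1 + s)) by nra.
      rewrite (Rabs_pos_eq (/ _)) by (apply Rlt_le, Rinv_0_lt_compat; lra).
      apply Rle_div_l; [lra|]. pose proof (Rabs_pos (s - t)). nra. }
    assert (H4 : (L + r) * Rabs (s - t) < e).
    { rewrite Rmult_comm. apply Rlt_div_r; lra. }
    split_Rabs; lra.
  - intros t Ht. rewrite beta_pos by easy. pose proof (envelope_nonneg r t Hr).
    pose proof (div_le_self r t ltac:(lra) Ht). lra.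
  - intros s t Hs Hst. rewrite !beta_pos by easy.
    pose proof (envelope_anti_t r s t Hr Hst).
    assert (r / (1 + t) <= r / (1 + s)); [|lra].
    apply Rmult_le_compat_l; [lra|]. apply Rinv_le_contravar; lra.
  - apply is_lim_spec. intros [e He]. simpl.
    destruct (attractive (2 * r) (e / 2)) as [tau Htau]; [lra|].
    exists (Rmax (tau + 1) (2 * r / e)). intros t Ht.
    pose proof (Rmax_l (tau + 1) (2 * r / e)).
    pose proof (Rmax_r (tau + 1) (2 * r / e)).
    assert (0 < 2 * r / e) by (apply Rdiv_lt_0_compat; lra).
    rewrite Rminus_0_r, beta_pos by easy.
    pose proof (envelope_nonneg r t Hr).
    pose proof (div_le_self r t ltac:(lra) ltac:(lra)).
    rewrite Rabs_pos_eq by lra.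
    assert (envelope r t <= e / 2).
    { apply envelope_le_of_tail; [easy|lra|]. intros i s Hn Hs Hts. apply Htau; lra. }
    assert (r / (1 + t) < e / 2); [|lra].
    apply Rlt_div_l; [lra|].
    assert (2 * r < t * e) by (apply Rlt_div_l; lra). lra.
Qed.

Lemma KL_bound_exists :
  exists b, class_KL b /\ forall i t, 0 <= t -> f i t <= b (n i) t.
Proof.
  exists beta. split; [split; [exact beta_class_K|exact beta_class_L]|].
  intros i t Ht. destruct (Rle_lt_or_eq_dec _ _ (n_pos i)) as [Hpos|Hz].
  - rewrite beta_pos by easy.
    pose proof (weighted_le_envelope (n i) t i t Hpos Ht) as H. unfold weighted in H.
    rewrite !clamp_1, !Rmult_1_r in H;
      [|lra|replace (n i / n i) with 1 by (field; lra); lra].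
    pose proof (div_le_self (n i) t (n_pos i) Ht). lra.
  - rewrite <- Hz, beta_at_0. apply Rle_plus_epsilon. intros e He.
    destruct (stable e He) as [delta [Hd H]]. specialize (H i t ltac:(lra) Ht). lra.
Qed.

End KL_bound.

(** * The flow *)

Section Flow.
Context {X : CompleteNormedModule R_AbsRing} {U : NormedModule R_AbsRing}.
Context (T : R -> X -> X) (D : U -> Prop) (g : X -> U -> X)
  (phi : R -> X -> (R -> U) -> X).
Context (hT : C0_semigroup T) (hLip : lipschitz_on_balls D g)
  (hRFC : robustly_forward_complete T g D phi)
  (h0 : equilibrium_at_0 D phi).

Lemma flow_at_0 x d : disturbance D d -> phi 0 x d = x.
Proof.
  intros hd. destruct (proj2 (proj1 hRFC x d hd) 0 (Rle_refl 0)) as [_ E].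
  rewrite E, RInt_point. destruct hT as [_ [hT0 _]]. rewrite hT0.
  apply @plus_zero_r.
Qed.

(** Both sides are mild solutions that start at [phi a x d] under the shifted
    disturbance. *)
Lemma flow_cocycle x d a t : disturbance D d -> 0 <= a -> 0 <= t ->
  phi (a + t) x d = phi t (phi a x d) (fun s => d (a + s)).
Proof.
  intros hd Ha Ht. pose proof (disturbance_shift D d a Ha hd) as hd'.
  exact (mild_solution_unique T D g hT hLip _ _ _ _ (proj1 hd')
    (mild_solution_restart T g hT x d (fun s => phi s x d) a Ha (proj1 hRFC x d hd))
    (proj1 hRFC (phi a x d) _ hd') t Ht).
Qed.

(** Compare with the zero trajectory; robust forward completeness provides a
    ball that contains both over the unit interval. *)
Lemma flow_small_on_unit_interval eps : 0 < eps -> exists delta, 0 < delta /\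
  forall x d t, disturbance D d -> norm x <= delta -> 0 <= t <= 1 ->
    norm (phi t x d) <= eps.
Proof.
  intros Heps. destruct hRFC as [hsol hbd].
  destruct (hbd 1 1 Rlt_0_1 Rlt_0_1) as [K HK].
  destruct (mild_solutions_close T D g hT hLip (Rmax K 1) 1) as [M [HM Hclose]].
  { apply Rlt_le_trans with (1 := Rlt_0_1), Rmax_r. }
  assert (Hd : 0 < eps / (M + 1)) by (apply Rdiv_lt_0_compat; lra).
  exists (Rmin 1 (eps / (M + 1))). split; [apply Rmin_glb_lt; lra|].
  intros x d t hd Hx Ht.
  pose proof (Rmin_l 1 (eps / (M + 1))). pose proof (Rmin_r 1 (eps / (M + 1))).
  assert (Hle : ndist (phi t x d) (phi t zero d) <= M * ndist x zero).
  { apply (Hclose x zero d (fun s => phi s x d) (fun s => phi s zero d)); try easy.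
    - apply hd.
    - now apply hsol.
    - now apply hsol.
    - intros s Hs. split.
      + apply Rle_trans with (2 := Rmax_l K 1). apply HK; [lra|easy|easy].
      + rewrite h0 by easy. rewrite (norm_zero (V := X)).
        apply Rle_trans with 1; [lra|apply Rmax_r]. }
  rewrite h0 in Hle by easy. rewrite !(ndist_zero_r (X := X)) in Hle.
  pose proof (norm_ge_0 x).
  assert (norm x * (M + 1) <= eps) by (apply Rle_div_r; lra). lra.
Qed.

(** * Decay of a non-coercive Lyapunov function *)

Context (V : X -> R) (psi2 alpha : R -> R).
Context (hVpos : forall x, 0 <= V x) (hVcont : forall x, continuous V x)
  (hV0 : V zero = 0) (hpsi : class_Kinf psi2) (halpha : class_K alpha)
  (hVle : forall x, x <> zero -> 0 < V x /\ V x <= psi2 (norm x))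
  (hVdot : forall x d, disturbance D d ->
     Rbar_le (lyapunov_derivative phi V x d) (Finite (- alpha (norm x)))).

Lemma lyapunov_le x : V x <= psi2 (norm x).
Proof.
  destruct (classic (x = zero)) as [->|Hx]; [|now apply hVle].
  rewrite hV0. apply Req_le. symmetry.
  exact (eq_trans (f_equal psi2 norm_zero) (proj2 (proj2 (proj1 hpsi)))).
Qed.

(** By the cocycle property, the Dini inequality at the state [phi s x d] and
    the shifted disturbance is one for [V] along the trajectory at time [s]. *)
Lemma lyapunov_drop x d a b c : disturbance D d -> 0 <= a <= b -> 0 <= c ->
  (forall s, a <= s <= b -> c <= norm (phi s x d)) ->
  V (phi b x d) <= V (phi a x d) - alpha c * (b - a).
Proof.
  intros hd Hab Hc Hlow.
  pose proof (lower_dini_decrease (fun s => V (phi (Rmax 0 s) x d)) a b (alpha c))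
    as H.
  cbv beta in H. rewrite !Rmax_right in H by lra. apply H; [lra| |].
  - intros s. apply (continuous_comp (fun s => phi (Rmax 0 s) x d) V).
    + exact (mild_solution_continuous T g _ _ _ (proj1 hRFC x d hd) s).
    + apply hVcont.
  - intros s Hs delta eps Hdelta Heps.
    destruct (liminf_right0_le _ _
      (hVdot (phi s x d) _ (disturbance_shift D d s ltac:(lra) hd)) delta eps)
      as [t [Ht Hq]]; try easy.
    exists t. split; [easy|]. rewrite !Rmax_right by lra.
    rewrite flow_cocycle by (easy || lra).
    assert (Ha : alpha c <= alpha (norm (phi s x d))).
    { apply class_K_le; [easy|easy|apply Hlow; lra]. }
    rewrite Rmult_comm in Hq. apply Rle_div_l in Hq; [|easy]. nra.
Qed.

Lemma lyapunov_le_initial x d t : disturbance D d -> 0 <= t ->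
  V (phi t x d) <= psi2 (norm x).
Proof.
  intros hd Ht.
  pose proof (lyapunov_drop x d 0 t 0 hd ltac:(lra) (Rle_refl 0)
                (fun s _ => norm_ge_0 _)) as H.
  destruct halpha as [_ [_ E]]. rewrite E, flow_at_0 in H by easy.
  pose proof (lyapunov_le x). lra.
Qed.

(** * Uniform stability and attractivity *)

(** The time [tau] is such that staying above [eps] on [[0, tau]] would use up
    [psi2 r + 1], more than [V x]. *)
Lemma uniform_limit r eps : 0 < eps -> exists tau, 0 <= tau /\
  forall x d, disturbance D d -> norm x <= r ->
  exists t, 0 <= t <= tau /\ norm (phi t x d) <= eps.
Proof.
  intros Heps. pose proof (class_K_pos alpha eps halpha Heps) as Ha.
  assert (Hp : 0 <= psi2 (Rmax 0 r)).
  { destruct hpsi as [hK _]. rewrite <- (proj2 (proj2 hK)) at 1.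
    apply class_K_le; [easy|lra|apply Rmax_l]. }
  assert (Htau : 0 <= (psi2 (Rmax 0 r) + 1) / alpha eps).
  { apply Rlt_le, Rdiv_lt_0_compat; lra. }
  exists ((psi2 (Rmax 0 r) + 1) / alpha eps). split; [easy|].
  intros x d hd Hx. apply NNPP; intros Hno.
  set (tau := (psi2 (Rmax 0 r) + 1) / alpha eps) in *.
  assert (Hdrop : V (phi tau x d) <= V (phi 0 x d) - alpha eps * (tau - 0)).
  { apply lyapunov_drop; [easy|lra|lra|]. intros s Hs.
    apply Rnot_lt_le; intros Hlt. apply Hno. exists s. split; [easy|lra]. }
  assert (Hpsi : psi2 (norm x) <= psi2 (Rmax 0 r)).
  { apply class_K_le; [apply hpsi|apply norm_ge_0|].
    apply Rle_trans with (1 := Hx), Rmax_r. }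
  rewrite flow_at_0 in Hdrop by easy.
  pose proof (lyapunov_le x). pose proof (hVpos (phi tau x d)).
  replace (alpha eps * (tau - 0)) with (psi2 (Rmax 0 r) + 1) in Hdrop
    by (unfold tau; field; lra). lra.
Qed.

(** Choose [d1] for [eps] by [flow_small_on_unit_interval]. A trajectory above
    [eps] at time [t] was above [d1] on all of [[t - 1, t]], and [V] lost at least
    [alpha d1] there; [d2] makes the initial value smaller than that. *)
Lemma uniform_stability eps : 0 < eps -> exists delta, 0 < delta /\
  forall x d t, disturbance D d -> norm x <= delta -> 0 <= t ->
    norm (phi t x d) <= eps.
Proof.
  intros Heps.
  destruct (flow_small_on_unit_interval eps Heps) as [d1 [Hd1 Hsmall]].
  pose proof (class_K_pos alpha d1 halpha Hd1) as Ha.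
  destruct (class_K_small psi2 (alpha d1 / 2) (proj1 hpsi)) as [d2 [Hd2 Hpsi]]; [lra|].
  exists (Rmin d1 d2). split; [now apply Rmin_glb_lt|].
  intros x d t hd Hx Ht. pose proof (Rmin_l d1 d2). pose proof (Rmin_r d1 d2).
  apply Rnot_lt_le; intros Hlt.
  destruct (Rle_dec t 1) as [Ht1|Ht1].
  { specialize (Hsmall x d t hd ltac:(lra) ltac:(lra)). lra. }
  assert (Hlow : forall s, t - 1 <= s <= t -> d1 <= norm (phi s x d)).
  { intros s Hs. apply Rnot_lt_le; intros Hs1.
    pose proof (flow_cocycle x d s (t - s) hd ltac:(lra) ltac:(lra)) as E.
    replace (s + (t - s)) with t in E by ring.
    specialize (Hsmall (phi s x d) _ (t - s)
      (disturbance_shift D d s ltac:(lra) hd) (Rlt_le _ _ Hs1) ltac:(lra)).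
    rewrite <- E in Hsmall. lra. }
  pose proof (lyapunov_drop x d (t - 1) t d1 hd ltac:(lra) ltac:(lra) Hlow) as Hdrop.
  pose proof (lyapunov_le_initial x d (t - 1) hd ltac:(lra)) as Hinit.
  pose proof (hVpos (phi t x d)).
  assert (psi2 (norm x) <= alpha d1 / 2)
    by (apply Hpsi; split; [apply norm_ge_0|lra]). lra.
Qed.

(** Within [tau] the trajectory visits the ball from which [uniform_stability]
    keeps it below [eps] forever. *)
Lemma uniform_attractivity r eps : 0 < eps -> exists tau, 0 <= tau /\
  forall x d t, disturbance D d -> norm x <= r -> tau <= t ->
    norm (phi t x d) <= eps.
Proof.
  intros Heps. destruct (uniform_stability eps Heps) as [delta [Hdelta Hst]].
  destruct (uniform_limit r delta Hdelta) as [tau [Htau Hlim]].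
  exists tau. split; [easy|]. intros x d t hd Hx Ht.
  destruct (Hlim x d hd Hx) as [s [Hs Hn]].
  pose proof (flow_cocycle x d s (t - s) hd ltac:(lra) ltac:(lra)) as E.
  replace (s + (t - s)) with t in E by ring. rewrite E.
  apply Hst; [apply disturbance_shift; easy|easy|lra].
Qed.

(** Robust forward completeness covers the time before attraction to the unit
    ball. *)
Lemma uniform_boundedness r : exists B, 0 <= B /\
  forall x d t, disturbance D d -> norm x <= r -> 0 <= t -> norm (phi t x d) <= B.
Proof.
  destruct (uniform_attractivity r 1 Rlt_0_1) as [tau [Htau Hatt]].
  pose proof (Rmax_r r 1) as Hr.
  destruct (proj2 hRFC (Rmax r 1) (tau + 1) ltac:(lra) ltac:(lra)) as [K HK].
  exists (Rmax K 1). split; [apply Rle_trans with (2 := Rmax_r K 1); lra|].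
  intros x d t hd Hx Ht. destruct (Rle_dec tau t) as [Hle|Hle].
  - apply Rle_trans with (2 := Rmax_r K 1). now apply Hatt.
  - apply Rle_trans with (2 := Rmax_l K 1). apply HK; [|lra|easy].
    apply Rle_trans with (1 := Hx), Rmax_l.
Qed.

End Flow.

Theorem corollary4p7
  (X : CompleteNormedModule R_AbsRing) (U : NormedModule R_AbsRing)
  (domA : X -> Prop) (A : X -> X) (T : R -> X -> X)
  (D : U -> Prop) (g : X -> U -> X) (phi : R -> X -> (R -> U) -> X)
  (hT : generates domA A T)
  (hD : exists u, D u)
  (hLip : lipschitz_on_balls D g)
  (hcont : forall x, continuous_on D (g x))
  (hRFC : robustly_forward_complete T g D phi)
  (h0 : equilibrium_at_0 D phi)
  (hV : exists V, noncoercive_lyapunov D phi V) :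
  UGAS D phi.
Proof.
  destruct hT as [hS _]. destruct hD as [u hu].
  destruct hV as [V [hVpos [hVcont [hV0 [psi2 [alpha [hpsi [halpha [hVle hVdot]]]]]]]]].
  destruct (KL_bound_exists {p : X * (R -> U) | disturbance D (snd p)}
    (fun p => norm (fst (proj1_sig p)))
    (fun p t => norm (phi t (fst (proj1_sig p)) (snd (proj1_sig p)))))
    as [beta [Hbeta Hb]].
  - exact (exist _ (zero, fun _ => u) (disturbance_const D u hu)).
  - intros p. apply norm_ge_0.
  - intros p t _. apply norm_ge_0.
  - intros eps Heps.
    destruct (uniform_stability T D g phi hS hLip hRFC h0 V psi2 alpha
      hVpos hVcont hV0 hpsi halpha hVle hVdot eps Heps) as [delta [Hd H]].
    exists delta. split; [easy|]. intros [[x d] hd] t Hn Ht. now apply H.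
  - intros r.
    destruct (uniform_boundedness T D g phi hS hLip hRFC h0 V psi2 alpha
      hVpos hVcont hV0 hpsi halpha hVle hVdot r) as [B [HB H]].
    exists B. split; [easy|]. intros [[x d] hd] t Hn Ht. now apply H.
  - intros r eps Heps.
    destruct (uniform_attractivity T D g phi hS hLip hRFC h0 V psi2 alpha
      hVpos hVcont hV0 hpsi halpha hVle hVdot r eps Heps) as [tau [_ H]].
    exists tau. intros [[x d] hd] t Hn _ Ht. now apply H.
  - exists beta. split; [easy|]. intros x d t hd Ht.
    exact (Hb (exist _ (x, d) hd) t Ht).
Qed.
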